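(* Let $n\ge 1$ and let $A$ be an expansive real $n\times n$ matrix. Suppose that the transpose $A^{*}$ has a real eigenvalue $\lambda\in\mathbb{R}$ with an associated eigenvector $v\in\mathbb{R}^n\setminus\{0\}$. Let $\psi$ be a radial function on $\mathbb{R}^n$ satisfying the standing hypothesis with respect to $A$ (see context), with $\widehat{\psi}$ supported in $\mathcal{A}(r,R)=\{\xi\in\mathbb{R}^n : r\le|\xi|\le R\}$, $0<r<R$, and suppose $|\lambda|>R/r$. Then the Calderón sum $$D_\psi(\xi)=\sum_{j\in\mathbb{Z}}\bigl|\widehat{\psi}\bigl((A^{*})^{-j}\xi\bigr)\bigr|^2,\qquad \xi\in\mathbb{R}^n\setminus\{0\},$$ does not satisfy $D_\psi\equiv 1$ almost everywhere on $\mathbb{R}^n\setminus\{0\}$. Moreover, there exists a nonempty open set $U\subset\mathbb{R}^n\setminus\{0\}$, of positive Lebesgue measure, such that $$D_\psi(\xi)=0\qquad\text{for every }\xi\in U.$$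
   Context: Fourier transform: $\hat f(\xi)=\int_{\mathbb{R}^n} f(x)e^{-2\pi i x\cdot\xi}\,dx$. $\mathcal{S}(\mathbb{R}^n)$ denotes the Schwartz functions; $|\cdot|$ is the Euclidean norm on $\mathbb{R}^n$. A real $n\times n$ matrix $A$ is expansive if every eigenvalue $\mu$ of $A$ satisfies $|\mu|>1$. Put $b:=|\det A|>1$, and let $|\lambda_-|$ be the smallest modulus of an eigenvalue of $A$. $A^*$ is the transpose of $A$. Step homogeneous quasi-norm (Bownik): there is an open ellipsoid $\Delta$ centred at $0$ with $|\Delta|=1$ and $\Delta\subset t\Delta\subset A\Delta$ for some $t>1$; fix one, put $B_k:=A^k\Delta$ ($k\in\mathbb{Z}$), and set $\rho_A(x)=b^k$ for $x\in B_{k+1}\setminus B_k$, $\rho_A(0)=0$. An anisotropic annulus is a set $\{\xi : r_A\le\rho_A(\xi)\le R_A\}$ with $0<r_A<R_A<\infty$. Standing hypothesis on $\psi$: $\psi\in\mathcal{S}(\mathbb{R}^n)$ (this is the meaning given to ''anisotropic decay adapted to $\rho_A$''); $\psi$ has vanishing moments $\int x^\alpha\psi(x)\,dx=0$ for $|\alpha|\le\mathcal{N}_p(A):=\lfloor(\tfrac1p-1)\tfrac{\ln b}{\ln|\lambda_-|}\rfloor$, for every $p\in(0,1]$; and $\hat\psi$ is supported in an anisotropic annulus contained in $[-1/2,1/2]^n\setminus\{0\}$. *)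

(* Defs.v *)
(* Points of R^n are column vectors ['cV[R]_n]. Where matrix powers are needed the
   dimension is written [n.+1], since ['M_n.+1] carries the ring structure. *)
From HB Require Import structures.
From mathcomp Require Import all_boot all_order all_algebra.
From mathcomp Require Import complex.
From mathcomp Require Import all_classical all_reals all_analysis.

Set Implicit Arguments.
Unset Strict Implicit.
Unset Printing Implicit Defensive.

Import Order.TTheory GRing.Theory Num.Theory.
Import numFieldNormedType.Exports.

Local Open Scope classical_set_scope.
Local Open Scope ring_scope.
Local Open Scope complex_scope.

(* The Borel sigma-algebra of R^n, generated by the coordinate projections. *)
Definition measure_cV_display : measure_display -> measure_display.
Proof. exact. Qed.

Section measurable_cV.
Context {R : realType} {n : nat}.

Definition cV_coord (i : 'I_n) (x : 'cV[R]_n) : measurableTypeR R := x i 0.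

Let cV_set0 : g_sigma_preimage cV_coord set0.
Proof. exact: sigma_algebra0. Qed.

Let cV_setC A : g_sigma_preimage cV_coord A -> g_sigma_preimage cV_coord (~` A).
Proof. exact: sigma_algebraC. Qed.

Let cV_bigcup (F : (set 'cV[R]_n)^nat) :
  (forall i, g_sigma_preimage cV_coord (F i)) ->
  g_sigma_preimage cV_coord (\bigcup_i F i).
Proof. exact: sigma_algebra_bigcup. Qed.

HB.instance Definition _ := @isMeasurable.Build
  (measure_cV_display (R.-ocitv.-measurable).-sigma)
  'cV[R]_n (g_sigma_preimage cV_coord) cV_set0 cV_setC cV_bigcup.

Lemma measurable_cV_coord (i : 'I_n) : measurable_fun [set: 'cV[R]_n] (cV_coord i).
Proof.
move=> _ Y mY; rewrite setTI; apply: sub_sigma_algebra => /=.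
rewrite -bigcup_seq/=; exists i => /=; first by rewrite mem_index_enum.
by exists Y => //; rewrite setTI.
Qed.

Lemma measurable_fun_cVP d (T : measurableType d) (f : T -> 'cV[R]_n) :
  (forall i, measurable_fun [set: T] (cV_coord i \o f)) ->
  measurable_fun [set: T] f.
Proof.
move=> mf.
suff H : g_sigma_preimage (fun i => cV_coord i \o f) `<=` measurable.
  move: H; rewrite g_sigma_preimage_comp => prefS.
  by move=> _ A mA; apply: prefS; exists A.
apply: smallest_sub; first exact: sigma_algebra_measurable.
rewrite -bigcup_seq /=; apply: bigcup_sub => i _ A [B mB <-].
exact: mf.
Qed.

End measurable_cV.

(* Lebesgue measure on R^n, by R^(1+n) = R x R^n; it is the usual Lebesgue measure
   restricted to Borel sets, and its completion enters only through the
   almost-everywhere notation [{ae mu, _}]. *)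
Section lebesgue_cV.
Context {R : realType}.

Definition cV_cons n (p : measurableTypeR R * 'cV[R]_n) : 'cV[R]_n.+1 :=
  col_mx (p.1 : R)%:M p.2.

Definition cV_uncons n (x : 'cV[R]_n.+1) : measurableTypeR R * 'cV[R]_n :=
  (x 0 0, \col_i x (lift 0 i) 0).

Lemma cV_cons0 n (p : measurableTypeR R * 'cV[R]_n) : cV_cons p 0 0 = p.1.
Proof.
have /= E := @col_mxEu _ 1 n 1 (p.1 : R)%:M p.2 0 0.
move: E; rewrite [RHS]mxE mulr1n => <-.
by congr (fun_of_matrix _ _ _); exact: val_inj.
Qed.

Lemma cV_consS n (p : measurableTypeR R * 'cV[R]_n) i :
  cV_cons p (lift 0 i) 0 = p.2 i 0.
Proof.
have /= <- := @col_mxEd _ 1 n 1 (p.1 : R)%:M p.2 i 0.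
by congr (fun_of_matrix _ _ _); exact: val_inj.
Qed.

Lemma cV_consK n : cancel (@cV_cons n) (@cV_uncons n).
Proof.
move=> [a x]; rewrite /cV_uncons cV_cons0; congr pair.
by apply/matrixP => i j; rewrite mxE (ord1 j) cV_consS.
Qed.

Lemma measurable_cV_cons n : measurable_fun setT (@cV_cons n).
Proof.
apply: measurable_fun_cVP => i; case: (unliftP 0 i) => [j|] ->.
- rewrite (_ : _ \o _ = cV_coord j \o snd); last first.
    by apply/funext => p /=; rewrite /cV_coord cV_consS.
  by apply: measurableT_comp; [exact: measurable_cV_coord|exact: measurable_snd].
- rewrite (_ : _ \o _ = fst); first exact: measurable_fst.
  by apply/funext => p /=; rewrite /cV_coord cV_cons0.
Qed.

Lemma measurable_cV_uncons n : measurable_fun setT (@cV_uncons n).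
Proof.
apply/measurable_fun_pairP; split.
- exact: measurable_cV_coord.
- apply: measurable_fun_cVP => i.
  rewrite (_ : _ \o _ = cV_coord (lift 0 i)); first exact: measurable_cV_coord.
  by apply/funext => x; rewrite /= /cV_coord mxE.
Qed.

Section step.
Variables (n : nat) (m : {sigma_finite_measure set 'cV[R]_n -> \bar R}).

Definition lebesgue_cV_step : set 'cV[R]_n.+1 -> \bar R :=
  pushforward (@lebesgue_measure R \x m)%E (@cV_cons n).

HB.instance Definition _ := Measure.copy lebesgue_cV_step
  (measure_function_pushforward__canonical__measure_function_Measure
     (@lebesgue_measure R \x m)%E (@measurable_cV_cons n)).

Let sigma_finite_step : sigma_finite setT lebesgue_cV_step.
Proof.
have /sigma_finiteP[F [TF ndF Foo]] := sigma_finiteT (@lebesgue_measure R).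
have /sigma_finiteP[G [TG ndG Goo]] := sigma_finiteT m.
exists (fun k => @cV_uncons n @^-1` (F k `*` G k)).
  rewrite -preimage_bigcup (_ : \bigcup_k _ = setT) ?preimage_setT//.
  rewrite -subTset => -[x y] _.
  have [i _ Fix] : (\bigcup_k F k) x by rewrite -TF.
  have [j _ Gjy] : (\bigcup_k G k) y by rewrite -TG.
  exists (maxn i j) => //; split => /=.
  - by move: x Fix; exact/subsetPset/ndF/leq_maxl.
  - by move: y Gjy; exact/subsetPset/ndG/leq_maxr.
move=> k; have [mF Fk] := Foo k; have [mG Gk] := Goo k; split.
  rewrite -[X in measurable X]setTI.
  by apply: measurable_cV_uncons => //; exact: measurableX.
rewrite /lebesgue_cV_step /pushforward -comp_preimage.
have -> : @cV_uncons n \o @cV_cons n = id by apply/funext => p; exact: cV_consK.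
by rewrite preimage_id product_measure1E// lte_mul_pinfty// ge0_fin_numE.
Qed.

HB.instance Definition _ := Measure_isSigmaFinite.Build _ _ _
  lebesgue_cV_step sigma_finite_step.

End step.

Fixpoint lebesgue_cV n : {sigma_finite_measure set 'cV[R]_n -> \bar R} :=
  if n is n'.+1 then lebesgue_cV_step (lebesgue_cV n') else \d_ (0 : 'cV[R]_0).

End lebesgue_cV.

Section euclidean.
Context {R : realType} {n : nat}.
Implicit Types (x y : 'cV[R]_n) (alpha : 'I_n -> nat).

Definition dotp x y : R := \sum_i x i 0 * y i 0.

(* The library norm [`|x|] on ['cV_n] is the sup norm; it defines the same topology. *)
Definition enorm x : R := Num.sqrt (dotp x x).

Definition monomial alpha x : R := \prod_i x i 0 ^+ alpha i.

Definition radial T (f : 'cV[R]_n -> T) :=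
  forall x y, enorm x = enorm y -> f x = f y.

Definition annulus (r s : R) : set 'cV[R]_n := [set x | r <= enorm x <= s].

Definition ellipsoid0 : set (set 'cV[R]_n) :=
  [set D | exists2 P : 'M[R]_n, P \in unitmx &
    D = [set P *m y | y in [set y : 'cV[R]_n | enorm y < 1]]].

End euclidean.

Section schwartz_fourier.
Context {R : realType} {n : nat}.
Implicit Types (f : 'cV[R]_n -> R[i]) (x xi : 'cV[R]_n).

(* The partial derivatives are indexed by words [s] of directions rather than by
   multi-indices; for smooth functions the order of differentiation is irrelevant. *)
Definition partials (s : seq 'I_n) (g : 'cV[R]_n -> R) : 'cV[R]_n -> R :=
  foldr (fun i h x => 'D_(delta_mx i 0) h x) g s.

Definition schwartz_real (g : 'cV[R]_n -> R) :=
  (forall s x, differentiable (partials s g) x) /\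
  (forall (alpha : 'I_n -> nat) s, exists C : R,
    forall x, `|monomial alpha x * partials s g x| <= C).

Definition schwartz f :=
  schwartz_real (fun x => complex.Re (f x)) /\
  schwartz_real (fun x => complex.Im (f x)).

Definition cintegral f : R[i] :=
  (\int[lebesgue_cV n]_x complex.Re (f x)) +i*
  (\int[lebesgue_cV n]_x complex.Im (f x)).

Definition cexpi (t : R) : R[i] := cos t +i* sin t.

Definition fourier f xi : R[i] :=
  cintegral (fun x => f x * cexpi (- (2 * pi * dotp x xi))).

Definition fsupport f : set 'cV[R]_n := closure [set x | f x != 0].

Definition vanishing_moment f (alpha : 'I_n -> nat) :=
  cintegral (fun x => (monomial alpha x)%:C * f x) = 0.

End schwartz_fourier.

Section anisotropic.
Context {R : realType} {n : nat}.
Implicit Types (A : 'M[R]_n.+1) (Delta : set 'cV[R]_n.+1).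
Implicit Types (psi : 'cV[R]_n.+1 -> R[i]).

(* The complex eigenvalues of the real matrix [A]; [eigenvalue] is phrased with row
   eigenvectors, which gives the same set as column eigenvectors. *)
Definition spectrum A : set R[i] :=
  [set mu | eigenvalue (map_mx (real_complex R) A) mu].

Definition expansive A := forall mu, spectrum A mu -> 1 < Normc.normc mu.

Definition min_eigenmod A : R := inf [set Normc.normc mu | mu in spectrum A].

Definition bownik_ellipsoid A Delta :=
  [/\ ellipsoid0 Delta,
      lebesgue_cV n.+1 Delta = 1%E &
      exists t : R, [/\ 1 < t,
        Delta `<=` [set t *: x | x in Delta] &
        [set t *: x | x in Delta] `<=` [set A *m x | x in Delta]]].

Definition bownik_ball A Delta (k : int) : set 'cV[R]_n.+1 :=
  [set (A ^ k) *m x | x in Delta].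

(* For [x != 0] the exponent is the unique [k] with x in B_(k+1) \ B_k; the default
   value 0 of [xget] is never used when [A] and [Delta] are as above. *)
Definition step_norm A Delta (x : 'cV[R]_n.+1) : R :=
  if x == 0 then 0 else
  `|\det A| ^ xget (0 : int)
    [set k : int | (bownik_ball A Delta (k + 1) `\` bownik_ball A Delta k) x].

Definition anisotropic_annulus A Delta (rA RA : R) : set 'cV[R]_n.+1 :=
  [set xi | rA <= step_norm A Delta xi <= RA].

Definition moment_order A (p : R) : int :=
  Num.floor ((p^-1 - 1) * (ln `|\det A| / ln (min_eigenmod A))).

Definition half_cube : set 'cV[R]_n.+1 :=
  [set xi | forall i, - 2^-1 <= xi i 0 <= 2^-1].

Definition standing_hypothesis A Delta psi :=
  [/\ schwartz psi,
      forall p : R, 0 < p <= 1 -> forall alpha : 'I_n.+1 -> nat,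
        (\sum_i alpha i)%:Z <= moment_order A p -> vanishing_moment psi alpha &
      exists rA RA : R, [/\ 0 < rA < RA,
        fsupport (fourier psi) `<=` anisotropic_annulus A Delta rA RA &
        anisotropic_annulus A Delta rA RA `<=` half_cube `\ 0]].

(* The sum over Z is an unconditional sum of nonnegative terms, in [0, +oo]. *)
Definition calderon_sum A psi (xi : 'cV[R]_n.+1) : \bar R :=
  \esum_(j in [set: int])
    (Normc.normc (fourier psi ((A^T ^ (- j)) *m xi)) ^+ 2)%:E.

End anisotropic.

(* Main.v *)
(* For s < tau < |lambda| r the vector xi0 on the line R v with |xi0| = tau has orbit
   |(A^T)^(-j) xi0| = |lambda|^(-j) tau, which jumps over the interval [r, s]. The
   ellipsoid inclusions t Delta <= A Delta give |(A^T)^(-k)| <= C t^(-k), so that near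
   xi0 all but finitely many points of the orbit automatically miss the annulus, and the
   remaining ones do so by continuity. Hence the sum vanishes on a ball around xi0. *)
Require Import Defs.
From mathcomp Require Import all_boot all_order all_algebra.
From mathcomp Require Import complex.
From mathcomp Require Import all_classical all_reals all_analysis.
From mathcomp Require Import lra.

Set Implicit Arguments.
Unset Strict Implicit.
Unset Printing Implicit Defensive.

Import Order.TTheory GRing.Theory Num.Theory.
Import numFieldNormedType.Exports.

Local Open Scope classical_set_scope.
Local Open Scope ring_scope.
Local Open Scope complex_scope.

(** * Comparison of the sup norm with the Euclidean norm *)

Lemma entry_le_norm (R : realType) m n (x : 'M[R]_(m, n)) i j :
  `|x i j| <= `|x|.
Proof.
rewrite [leRHS]/Num.norm /= mx_normrE.
exact: (le_bigmax _ (fun ij => `|x ij.1 ij.2|) (i, j)).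
Qed.

Lemma norm_le_entries (R : realType) m n (x : 'M[R]_(m, n)) c : 0 <= c ->
  (forall i j, `|x i j| <= c) -> `|x| <= c.
Proof.
move=> c0 xc; rewrite [leLHS]/Num.norm /= mx_normrE.
by apply/bigmax_leP; split=> // ij _; exact: xc.
Qed.

(** The sup norm on entries is submultiplicative only up to the inner dimension [n], the number of
    terms in each entry of the product. *)
Lemma norm_mulmx (R : realType) m n p (M : 'M[R]_(m, n)) (N : 'M[R]_(n, p)) :
  `|M *m N| <= n%:R * `|M| * `|N|.
Proof.
apply: norm_le_entries => [|i j]; first by rewrite !mulr_ge0.
rewrite mxE (le_trans (ler_norm_sum _ _ _))//.
apply: (@le_trans _ _ (\sum_(k < n) `|M| * `|N|)).
  by apply: ler_sum => k _; rewrite normrM ler_pM// entry_le_norm.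
by rewrite sumr_const card_ord -[leLHS]mulr_natl mulrA.
Qed.

Lemma norm_le_enorm (R : realType) n (x : 'cV[R]_n) : `|x| <= enorm x.
Proof.
apply: norm_le_entries => [|i j]; first exact: sqrtr_ge0.
rewrite (ord1 j) -sqrtr_sqr ler_wsqrtr// /dotp (bigD1 i)//= -expr2 lerDl.
by apply: sumr_ge0 => k _; rewrite -expr2 sqr_ge0.
Qed.

Lemma enorm_le_norm (R : realType) n (x : 'cV[R]_n) :
  enorm x <= Num.sqrt n%:R * `|x|.
Proof.
rewrite -[X in _ * X]ger0_norm// -sqrtr_sqr -sqrtrM// ler_wsqrtr//.
apply: (@le_trans _ _ (\sum_(k < n) `|x| ^+ 2)).
  apply: ler_sum => k _; rewrite -expr2 -real_normK ?num_real//.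
  by rewrite lerXn2r ?nnegrE// entry_le_norm.
by rewrite sumr_const card_ord mulr_natl.
Qed.

Lemma enormZ (R : realType) n (c : R) (x : 'cV[R]_n) :
  enorm (c *: x) = `|c| * enorm x.
Proof.
rewrite -sqrtr_sqr -sqrtrM ?sqr_ge0//; congr Num.sqrt.
by rewrite mulr_sumr; apply: eq_bigr => i _; rewrite !mxE mulrACA.
Qed.

Lemma enorm_gt0 (R : realType) n (x : 'cV[R]_n) : x != 0 -> 0 < enorm x.
Proof. by move=> x0; rewrite (lt_le_trans _ (norm_le_enorm _))// normr_gt0. Qed.

Lemma enorm_mulmx_continuous (R : realType) m n (M : 'M[R]_(m, n)) :
  continuous (fun x : 'cV[R]_n => enorm (M *m x)).
Proof.
have cM i : continuous (fun x : 'cV[R]_n => (M *m x) i 0).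
  rewrite (_ : (fun _ => _) = (fun x : 'cV[R]_n => \sum_j M i j * x j 0)).
    apply: (@continuous_big _ _ +%R 0 xpredT (@add_continuous R) _ _
      (fun j (x : 'cV[R]_n) => M i j * x j 0)) => j _ x.
    by apply: continuousM; [exact: cst_continuous|exact: coord_continuous].
  by apply/funext => y; rewrite mxE.
have cdot : continuous (fun x : 'cV[R]_n => dotp (M *m x) (M *m x)).
  apply: (@continuous_big _ _ +%R 0 xpredT (@add_continuous R) _ _
      (fun i (x : 'cV[R]_n) => (M *m x) i 0 * (M *m x) i 0)) => i _ x.
  by apply: continuousM; exact: cM.
move=> x; apply: (continuous_comp (cdot x)); exact: sqrt_continuous.
Qed.

(** Missing the annulus, on its inner or its outer side, is a strict inequality on a continuous
    function of the point, hence survives a small perturbation. *)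
Lemma notin_annulus_near (R : realType) m n (M : 'M[R]_(m, n)) r s
    (x : 'cV[R]_n) :
  ~ annulus r s (M *m x) -> \forall y \near x, ~ annulus r s (M *m y).
Proof.
rewrite /annulus/= => /negP; rewrite negb_and -!ltNge => /orP[xr|sx].
- near=> y => /andP[+ _]; apply/negP; rewrite -ltNge; near: y.
  exact: (@enorm_mulmx_continuous _ _ _ M x _ (lt_nbhsl xr)).
- near=> y => /andP[_]; apply/negP; rewrite -ltNge; near: y.
  exact: (@enorm_mulmx_continuous _ _ _ M x _ (lt_nbhsr sx)).
Unshelve. all: by end_near. Qed.

(** * Measure of sup-norm balls *)

(** Sup-norm balls are boxes; this matches the recursive product construction of [lebesgue_cV] and
    lets the next two lemmas go by induction on [n]. *)
Lemma ball_cV_uncons (R : realType) n (x : 'cV[R]_n.+1) e :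
  ball x e = @cV_uncons R n @^-1`
    (ball ((cV_uncons x).1 : R) e `*` ball (cV_uncons x).2 e).
Proof.
apply/seteqP; split => y /=.
- case=> e0 xy; split; first exact: xy.
  by split=> // i j; rewrite !mxE; exact: xy.
- case=> xy0 [e0 xy]; split=> // i j; rewrite (ord1 j).
  case: (unliftP 0 i) => [k|] ->; last exact: xy0.
  by have := xy k 0; rewrite !mxE.
Qed.

Lemma measurable_ball_cV (R : realType) n (x : 'cV[R]_n) e :
  measurable (ball x e).
Proof.
elim: n x => [|n IHn] x.
  (* A ball of matrices carries the condition [0 < e], so in dimension 0 it is everything or
     empty. *)
  have [e0|e0] := ltP 0 e.
    rewrite (_ : ball x e = setT); first exact: measurableT.
    by apply/seteqP; split=> // y _; split=> // -[].
  rewrite (_ : ball x e = set0); first exact: measurable0.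
  by apply/seteqP; split=> // y [e1]; have := lt_le_trans e1 e0; rewrite ltxx.
rewrite ball_cV_uncons -[X in measurable X]setTI.
apply: measurable_cV_uncons => //; apply: measurableX => //.
by rewrite ball_itv; exact: measurable_itv.
Qed.

Lemma lebesgue_cV_ball_gt0 (R : realType) n (x : 'cV[R]_n) e : 0 < e ->
  (0 < lebesgue_cV n (ball x e))%E.
Proof.
move=> e0; elim: n x => [|n IHn] x.
  by rewrite /= diracE mem_set ?lte01//; split=> // -[].
rewrite /= /lebesgue_cV_step /pushforward ball_cV_uncons -comp_preimage.
have -> : @cV_uncons R n \o @cV_cons R n = id by apply/funext => p; exact: cV_consK.
rewrite preimage_id product_measure1E;
  [|by rewrite ball_itv; exact: measurable_itv|exact: measurable_ball_cV].
rewrite mule_gt0// [X in (0 < X)%E](@lebesgue_measure_ball R) ?ltW//.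
by rewrite lte_fin mulrn_wgt0.
Qed.

(** * Invertibility, powers and transposes of matrices *)

Lemma expansive_unitmx (R : realType) n (A : 'M[R]_n.+1) :
  expansive A -> A \in unitmx.
Proof.
move=> hA; apply: contraT => nA.
suff /hA : spectrum A 0 by rewrite Normc.normc0 ltr10.
by rewrite /spectrum/= /eigenvalue /eigenspace raddf0 subr0 kermx_eq0
  row_free_unit map_unitmx.
Qed.

Lemma mulmx_expr_eigen (R : realType) n (M : 'M[R]_n.+1) (mu : R)
    (v : 'cV[R]_n.+1) k :
  M *m v = mu *: v -> M ^+ k *m v = mu ^+ k *: v.
Proof.
move=> Mv; elim: k => [|k IHk]; first by rewrite !expr0 mul1mx scale1r.
by rewrite exprS -mulmxE -mulmxA IHk -scalemxAr Mv scalerA -exprSr.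
Qed.

Lemma trmx_expr (R : realType) n (M : 'M[R]_n.+1) k : (M ^+ k)^T = M^T ^+ k.
Proof.
elim: k => [|k IHk]; first by rewrite !expr0 trmx1.
by rewrite exprS -mulmxE trmx_mul IHk exprSr.
Qed.

Lemma norm_trmx_le (R : realType) m n (M : 'M[R]_(m, n)) : `|M^T| <= `|M|.
Proof. by apply: norm_le_entries => // i j; rewrite mxE entry_le_norm. Qed.

Lemma enorm_delta (R : realType) n (j : 'I_n) :
  enorm (delta_mx j 0 : 'cV[R]_n) = 1.
Proof.
rewrite /enorm /dotp (bigD1 j)//= big1 => [|i ij].
  by rewrite !mxE !eqxx mulr1 addr0 sqrtr1.
by rewrite !mxE (negbTE ij) mul0r.
Qed.

(** * Geometric decay of inverse powers *)

(** The basis vectors lie outside the open unit ball, so [M] is tested on their halves, whence the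
    factor 2. *)
Lemma norm_le_enorm_unit_ball (R : realType) m n (M : 'M[R]_(m, n)) c :
  0 <= c -> (forall y, enorm y < 1 -> enorm (M *m y) <= c) -> `|M| <= 2 * c.
Proof.
move=> c0 Mc; apply: norm_le_entries => [|i j]; first by rewrite mulr_ge0.
have : enorm (M *m (2^-1 *: (delta_mx j 0 : 'cV[R]_n))) <= c.
  by apply: Mc; rewrite enormZ enorm_delta mulr1 ger0_norm ?invr_ge0//
    invf_lt1// ltr1n.
rewrite -scalemxAr enormZ ger0_norm ?invr_ge0// ler_pdivrMl//.
apply: le_trans; apply: le_trans (norm_le_enorm _).
suff -> : M i j = (M *m (delta_mx j 0 : 'cV[R]_n)) i 0 by exact: entry_le_norm.
rewrite mxE (bigD1 j)//= big1 => [|k kj]; rewrite !mxE ?eqxx ?mulr1 ?addr0//.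
by rewrite (negbTE kj) mulr0.
Qed.

(** In coordinates where [Delta] is the open unit ball, the inclusion of [t *: Delta] in the image
    of [Delta] under [A] says that [t] times the inverse of [A] maps the ball into itself. Iterating
    gives the rate [t^-1]; changing coordinates back and transposing cost only a constant. *)
Lemma bownik_ellipsoid_decay (R : realType) n (A : 'M[R]_n.+1)
    (Delta : set 'cV[R]_n.+1) :
  A \in unitmx -> bownik_ellipsoid A Delta ->
  exists C q : R, [/\ 0 <= C, 0 <= q < 1 &
    forall k (x : 'cV[R]_n.+1), `|A^T^-1 ^+ k *m x| <= C * q ^+ k * `|x|].
Proof.
move=> uA [[P uP ->] _ [t [t1 _ tA]]].
have t0 : 0 < t by rewrite (lt_trans ltr01).
have [Q QE] : exists Q : 'M[R]_n.+1, Q = invmx P *m A^-1 *m P by eexists.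
have QP : Q *m invmx P = invmx P *m A^-1 by rewrite QE mulmxK.
have Qk k : A^-1 ^+ k = P *m Q ^+ k *m invmx P.
  elim: k => [|k IHk]; first by rewrite !expr0 mulmx1 mulmxV.
  by rewrite !exprSr IHk -!mulmxE -!mulmxA QP.
have Qball k y : enorm y < 1 -> enorm (Q ^+ k *m y) <= t^-1 ^+ k.
  move=> y1; suff : enorm (t ^+ k *: (Q ^+ k *m y)) < 1.
    rewrite enormZ gtr0_norm ?exprn_gt0// => H.
    by rewrite exprVn -[leRHS]mulr1 ler_pdivlMl ?exprn_gt0// ltW.
  elim: k => [|k IHk]; first by rewrite !expr0 mul1mx scale1r.
  set z := t ^+ k *: _ in IHk.
  (* The inclusion at [P *m z] gives [w] in the unit ball with [A *m (P *m w) = t *: (P *m z)], so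
     [w] is [t *: (Q *m z)], the next iterate. *)
  have [_ [w w1 <-] Aw] : [set A *m x | x in
      [set P *m y | y in [set y : 'cV[R]_n.+1 | enorm y < 1]]] (t *: (P *m z)).
    by apply: tA; exists (P *m z) => //; exists z.
  suff -> : t ^+ k.+1 *: (Q ^+ k.+1 *m y) = w by [].
  rewrite exprS -scalerA exprS -mulmxE -mulmxA -/z scalemxAr -/z.
  rewrite scalemxAr -(mulKmx uP w) -(mulKmx uA (P *m w)) Aw.
  by rewrite QE !scalemxAr -!mulmxA.
(* Each dimension factor comes from one use of [norm_mulmx], and the 2 from
   [norm_le_enorm_unit_ball]. *)
exists (n.+1%:R * (n.+1%:R * (n.+1%:R * `|P| * 2) * `|invmx P|)), t^-1.
split=> [||k x]; first by rewrite !mulr_ge0.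
  by rewrite invr_ge0 ltW//= invf_lt1.
rewrite -trmxV -trmx_expr (le_trans (norm_mulmx _ _))//.
rewrite ler_wpM2r// -[leRHS]mulrA ler_wpM2l// (le_trans (norm_trmx_le _))//.
rewrite Qk (le_trans (norm_mulmx _ _))// [leRHS]mulrAC ler_wpM2r//.
rewrite -[leRHS]mulrA ler_wpM2l// (le_trans (norm_mulmx _ _))//.
rewrite -[leRHS]mulrA ler_wpM2l ?mulr_ge0//.
apply: norm_le_enorm_unit_ball; last exact: Qball.
by rewrite exprn_ge0// invr_ge0 ltW.
Qed.

(** * Orbits that avoid the annulus *)

(** The decay bound serves twice. For large [j] it pushes the orbit of a bounded [y] inside radius
    [r]. For very negative [j], an orbit point in the annulus has norm at most [s], and pulling it
    back by the decaying powers would put [y] too close to 0, although [y] stays near [x != 0]. *)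
Lemma orbit_notin_annulus_near (R : realType) n (B : 'M[R]_n.+1)
    (C q r s : R) (x : 'cV[R]_n.+1) :
  B \in unitmx -> 0 <= C -> 0 <= q < 1 -> 0 < r ->
  (forall k (y : 'cV[R]_n.+1), `|B^-1 ^+ k *m y| <= C * q ^+ k * `|y|) ->
  x != 0 -> (forall j : int, ~ annulus r s (B ^ (- j) *m x)) ->
  \forall y \near x, forall j : int, ~ annulus r s (B ^ (- j) *m y).
Proof.
move=> uB C0 /andP[q0 q1] r0 decay x0 Bx.
have nx0 : 0 < `|x| by rewrite normr_gt0.
have small K e : 0 < e -> \forall k \near \oo, C * q ^+ k * K < e.
  move=> e0.
  have q1' : `|q| < 1 by rewrite ger0_norm.
  have := @cvg_geometric R (C * K) q q1'.
  move=> /cvgrPdist_lt/(_ _ e0); apply: filterS => k.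
  by rewrite sub0r normrN /= mulrAC; apply: le_lt_trans; rewrite ler_norm.
(* In the first bound [|x| + 1] dominates [|y|] and the square root converts sup norm to Euclidean
   norm; in the second, [|x| / 2] is the lower bound on [|y|] to be contradicted. *)
have [N _ HN] : \forall k \near \oo,
    C * q ^+ k * (Num.sqrt n.+1%:R * (`|x| + 1)) < r /\ C * q ^+ k * s < `|x| / 2.
  near=> k; split; near: k; apply: small => //.
  by rewrite divr_gt0.
near=> y.
have yx : `|y| < `|x| + 1.
  near: y.
  by apply: (cvgr_lt (`|x|)); [exact: norm_continuous|rewrite ltrDl].
have xy : `|x| / 2 < `|y|.
  near: y.
  apply: (cvgr_gt (`|x|)); first exact: norm_continuous.
  by rewrite ltr_pdivrMr// ltr_pMr// ltr1n.
have ypos : forall i : 'I_N, ~ annulus r s (B^-1 ^+ i *m y).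
  near: y; apply: filter_forall => i; apply: notin_annulus_near.
  by have := Bx i; rewrite -exprnN exprVn.
(* [Negz k] stands for [-(k + 1)], so the index [i] encodes the power [i.+1]. *)
have yneg : forall i : 'I_N, ~ annulus r s (B ^+ i.+1 *m y).
  near: y; apply: filter_forall => i; apply: notin_annulus_near.
  by have := Bx (- i.+1%:Z); rewrite opprK.
case=> k.
- rewrite -exprnN -exprVn; have [kN|Nk] := ltnP k N.
    exact: (ypos (Ordinal kN)).
  apply/negP; rewrite /annulus/= negb_and -!ltNge; apply/orP; left.
  have [+ _] := HN k Nk; apply: le_lt_trans.
  rewrite (le_trans (enorm_le_norm _))// mulrCA ler_wpM2l ?sqrtr_ge0//.
  rewrite (le_trans (decay k y))//.
  by apply: ler_wpM2l; [rewrite mulr_ge0// exprn_ge0|exact: ltW].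
- rewrite NegzE opprK; have [kN|Nk] := ltnP k N; first exact: (yneg (Ordinal kN)).
  move=> /andP[_ ys].
  have [_] := HN k.+1 (leqW Nk); apply/negP; rewrite -leNgt.
  rewrite (le_trans (ltW xy))//.
  rewrite -[y](_ : B^-1 ^+ k.+1 *m (B ^+ k.+1 *m y) = y); last first.
    rewrite mulmxA mulmxE exprVn mulVr ?mul1mx//; exact: unitrX.
  rewrite (le_trans (decay _ _))//.
  rewrite ler_wpM2l ?mulr_ge0 ?exprn_ge0//.
  exact: le_trans (norm_le_enorm _) ys.
Unshelve. all: by end_near. Qed.

Lemma calderon_sum_eq0 (R : realType) n (A : 'M[R]_n.+1) psi
    (r s : R) xi :
  fsupport (fourier psi) `<=` annulus r s ->
  (forall j : int, ~ annulus r s (A^T ^ (- j) *m xi)) ->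
  calderon_sum A psi xi = 0%E.
Proof.
move=> hsupp hxi; apply: esum1 => j _.
have [->|F0] := eqVneq (fourier psi (A^T ^ (- j) *m xi)) 0.
  by rewrite Normc.normc0 expr0n.
by case: (hxi j); apply: hsupp; exact: subset_closure.
Qed.

(** The hypotheses force [|lambda| > 1]. Nonnegative powers of [B] therefore keep the norm at least
    [tau > s], while negative powers bring it down to at most [tau / |lambda| < r]. *)
Lemma eigenvector_orbit_notin_annulus (R : realType) n (B : 'M[R]_n.+1)
    (lambda r s tau : R) (v : 'cV[R]_n.+1) :
  B \in unitmx -> v != 0 -> B *m v = lambda *: v ->
  0 < r < s -> s < tau < `|lambda| * r ->
  forall j : int, ~ annulus r s (B ^ (- j) *m ((tau / enorm v) *: v)).
Proof.
move=> uB v0 Bv /andP[r0 rs] /andP[stau taur].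
have s0 : 0 < s := lt_trans r0 rs.
have tau0 : 0 < tau := lt_trans s0 stau.
have lambda1 : 1 < `|lambda|.
  by rewrite -(ltr_pM2r r0) mul1r (lt_trans rs)// (lt_trans stau).
have lambda0 : lambda != 0 by rewrite -normr_gt0 (lt_trans ltr01).
have BVv : B^-1 *m v = lambda^-1 *: v.
  apply: (can_inj (mulKmx uB)); rewrite mulmxA mulmxE mulrV// mul1mx.
  by rewrite -scalemxAr Bv scalerA mulVf// scale1r.
have enormE c : enorm (c *: ((tau / enorm v) *: v)) = `|c| * tau.
  rewrite !enormZ normrM normfV (gtr0_norm tau0) (gtr0_norm (enorm_gt0 v0)).
  by rewrite divfK// gt_eqF// enorm_gt0.
have outer k : ~ annulus r s (B ^+ k *m ((tau / enorm v) *: v)).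
  rewrite -scalemxAr (mulmx_expr_eigen _ Bv) scalerA [X in X *: _]mulrC -scalerA.
  move=> /andP[_]; apply/negP; rewrite -ltNge enormE normrX (lt_le_trans stau)//.
  by rewrite ler_peMl ?(ltW tau0)// exprn_ege1// ltW.
(* The index 0 belongs to the outer case, because [tau] lies beyond [s]. *)
case=> [[|k]|k]; [exact: (outer 0%N)| |by rewrite NegzE opprK; exact: outer].
rewrite -exprnN -exprVn -scalemxAr (mulmx_expr_eigen _ BVv) scalerA
  [X in X *: _]mulrC -scalerA.
move=> /andP[+ _]; apply/negP; rewrite -ltNge enormE normrX normfV.
rewrite exprVn ltr_pdivrMl ?exprn_gt0 ?normr_gt0// (lt_le_trans taur)//.
by rewrite ler_pM2r// exprS ler_peMr// exprn_ege1// ltW.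
Qed.

Theorem corollary2 (R : realType) (n : nat) (A : 'M[R]_n.+1)
    (hA : expansive A)
    (lambda : R) (v : 'cV[R]_n.+1) (hv : v != 0)
    (hlambda : A^T *m v = lambda *: v)
    (Delta : set 'cV[R]_n.+1) (hDelta : bownik_ellipsoid A Delta)
    (psi : 'cV[R]_n.+1 -> R[i]) (hradial : radial psi)
    (hpsi : standing_hypothesis A Delta psi)
    (r s : R) (hrs : 0 < r < s)
    (hsupp : fsupport (fourier psi) `<=` annulus r s)
    (hgap : s / r < `|lambda|) :
  ~ {ae lebesgue_cV n.+1, forall xi, xi != 0 -> calderon_sum A psi xi = 1%E} /\
  exists U : set 'cV[R]_n.+1,
    [/\ open U, U !=set0, U `<=` [set xi | xi != 0],
        (0 < lebesgue_cV n.+1 U)%E &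
        forall xi, U xi -> calderon_sum A psi xi = 0%E].
Proof.
have [r0 _] := andP hrs.
have [tau htau] : exists tau, s < tau < `|lambda| * r.
  (* The midpoint works because [s / r < |lambda|] makes the interval nonempty. *)
  exists ((s + `|lambda| * r) / 2).
  by rewrite !(midf_lt, andbT)//; rewrite -ltr_pdivrMr.
have uA := expansive_unitmx hA.
have uAT : A^T \in unitmx by rewrite unitmx_tr.
have [C [q [C0 q01 decay]]] := bownik_ellipsoid_decay uA hDelta.
pose xi0 := (tau / enorm v) *: v.
have xi0_neq0 : xi0 != 0.
  rewrite scaler_eq0 negb_or hv andbT mulf_neq0// ?invr_neq0//.
    by case/andP: hrs htau => + + /andP[+ _]; lra.
  by rewrite gt_eqF// enorm_gt0.
have orbit0 :=
  eigenvector_orbit_notin_annulus uAT hv hlambda hrs htau.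
have near0 :=
  orbit_notin_annulus_near uAT C0 q01 r0 decay xi0_neq0 orbit0.
(* The ball extracted here serves as the open set [U]. *)
have /nbhs_ballP[e /= e0 Ue] : nbhs xi0
    [set xi : 'cV[R]_n.+1 | xi != 0 /\ calderon_sum A psi xi = 0%E].
  near=> xi; split; last first.
    by apply: (calderon_sum_eq0 hsupp); near: xi.
  rewrite -normr_gt0; near: xi.
  by apply: (cvgr_gt `|xi0|); [exact: norm_continuous|rewrite normr_gt0].
have Ugt0 := lebesgue_cV_ball_gt0 xi0 e0.
split; last first.
  exists (ball xi0 e); split => //.
  - exact: ball_open.
  - by exists xi0; exact: ballxx.
  - by move=> xi /Ue[].
  - by move=> xi /Ue[].
(* A null set [N] containing every nonzero point where the sum differs from 1 contains this ball,
   where the sum is 0; that contradicts the positive measure of the ball. *)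
move=> [N [mN N0 subN]].
suff : (lebesgue_cV n.+1 (ball xi0 e) <= 0)%E by rewrite leNgt Ugt0.
rewrite -N0; apply: le_measure; rewrite ?inE//; first exact: measurable_ball_cV.
apply: subset_trans subN => xi /Ue[xi_neq0 xi_eq0] /(_ xi_neq0).
by rewrite xi_eq0 => /eqP; rewrite eqe eq_sym oner_eq0.
Unshelve. all: by end_near. Qed.
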